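(* There are infinitely many positive rational values $a$ for which there exist positive rational initial conditions $x_0(a),x_1(a)$ such that the sequence given by the Lyness recurrence $$x_{n+2}=\frac{a+x_{n+1}}{x_n}$$ with $x_0=x_0(a)$, $x_1=x_1(a)$ is $9$-periodic. Furthermore, the closure (in $\mathbb{R}$) of the set of these values of $a$ contains the real interval $[a_1,+\infty)$, where $a_1\simeq 5.41147624$ is the biggest real root of $a^3-\frac{2019}{529}a^2-\frac{777}{92}a-1$.
   Context: ''$9$-periodic'' means periodic with prime (least) period exactly $9$, i.e. $9$ is the least integer $p\ge1$ with $x_{n+p}=x_n$ for all $n\ge 0$ (in particular constant sequences are not counted). *)

(* Defs.v *)
From HB Require Import structures.
From mathcomp Require Import all_boot all_order all_algebra.
From mathcomp Require Import all_classical all_reals all_analysis.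

Set Implicit Arguments.
Unset Strict Implicit.
Unset Printing Implicit Defensive.

Import Order.TTheory GRing.Theory Num.Theory.
Import numFieldNormedType.Exports.
Local Open Scope classical_set_scope.
Local Open Scope ring_scope.

(* The state (x_n, x_(n+1)) is iterated; [lynessSS] below is the recurrence.
   Division by zero is total (x / 0 = 0 in a field), but it never occurs for
   positive a, x0, x1, since all terms are then positive. *)
Definition lyness (a x0 x1 : rat) (n : nat) : rat :=
  (iter n (fun u : rat * rat => (u.2, (a + u.2) / u.1)) (x0, x1)).1.

Lemma lyness0 (a x0 x1 : rat) : lyness a x0 x1 0%N = x0.
Proof. by []. Qed.

Lemma lyness1 (a x0 x1 : rat) : lyness a x0 x1 1%N = x1.
Proof. by []. Qed.

Lemma lynessSS (a x0 x1 : rat) (n : nat) :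
  lyness a x0 x1 n.+2 = (a + lyness a x0 x1 n.+1) / lyness a x0 x1 n.
Proof. by []. Qed.

Definition has_period (T : Type) (x : nat -> T) (p : nat) : Prop :=
  forall n : nat, x (n + p)%N = x n.

Definition least_period (T : Type) (x : nat -> T) (p : nat) : Prop :=
  [/\ (0 < p)%N, has_period x p &
      forall q : nat, (0 < q)%N -> has_period x q -> (p <= q)%N].

Definition lyness9_values : set rat :=
  [set a : rat | 0 < a /\
     exists x0 x1 : rat,
       [/\ 0 < x0, 0 < x1 & least_period (lyness a x0 x1) 9%N] ].

Definition lyness9_poly (R : realType) : {poly R} :=
  'X^3 - (2019%:R / 529%:R) *: 'X^2 - (777%:R / 92%:R) *: 'X - 1.

Definition biggest_root (R : realType) (p : {poly R}) (r : R) : Prop :=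
  root p r /\ forall s : R, root p s -> s <= r.

(* Main.v *)
Require Import Defs.
From HB Require Import structures.
From Stdlib Require Import ZArith.
From mathcomp Require Import all_boot all_order all_algebra.
From mathcomp Require Import all_classical all_reals all_analysis.
From mathcomp Require Import ssrZ zify ring lra.

(* The Lyness map preserves the cubics
   [(x + 1) (y + 1) (x + y + a) = h x y] and acts on each by a translation,
   which has order 9 when [h = (a - 1) (a^2 - a + 1) / a].  On the slice
   [x + y = 23/4] of the resulting surface the condition becomes
   [w^2 = (a - 4) (a^3 - 2019/529 a^2 - 777/92 a - 1)], a curve of genus 1
   because 23/4 makes a quadratic factor a square.  With [V = 12 / (a - 4)]
   it is [W^2 = - 624 V^3 + 2121 V^2 + 23088 V + 184^2]; the slope [n] of the
   line through [(0, 184)] and [(V, W)] turns it into [m^2 = quartic n] with a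
   positive quartic, so that the component [m > 0] is a circle, namely the real
   line of the [n]'s together with the neutral element at infinity.  Its
   rational points form a subgroup.  The subgroup is infinite, because repeated
   doubling of a point close to infinity in the 2-adic metric strictly decreases
   a 2-adic valuation.  Hence two of its points are close, their difference is
   close to infinity, and stepping by this small element meets every interval. *)

Set Implicit Arguments.
Unset Strict Implicit.
Unset Printing Implicit Defensive.

Import Order.TTheory GRing.Theory Num.Theory.
Import numFieldNormedType.Exports.
Local Open Scope classical_set_scope.
Local Open Scope ring_scope.
Local Delimit Scope Z_scope with Z.

(** * The quartic and its chord law *)

Definition quartic (F : realFieldType) (al be ga n : F) : F :=
  n ^+ 4 + al * n ^+ 2 + be * n + ga.

(* The map [(n, m) |-> (t, 2 t n + be)], where [t = 2 (n^2 + m) + al], sends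
   [m^2 = quartic n] to the Weierstrass curve [s^2 = resolvent t]. *)
Definition resolvent (F : realFieldType) (al be ga t : F) : F :=
  t * ((t - al) ^+ 2 - 4 * ga) + be ^+ 2.

(** Reduces an equality that follows linearly from a known one to an identity that [ring] can check;
    [k] is the cofactor. *)
Lemma eq_of_cert (F : realFieldType) (k A B X Y : F) :
  X - Y = k * (A - B) -> A = B -> X = Y.
Proof. by move=> h e; apply/eqP; rewrite -subr_eq0 h e subrr mulr0. Qed.

(* A [t0 > 0] where the resolvent is negative separates the values of [t] on the
   two components of the curve. *)
Lemma component_sign (F : realFieldType) (al be ga t0 n m : F) :
  0 < t0 -> resolvent al be ga t0 < 0 -> m ^+ 2 = quartic al be ga n ->
  (t0 - (2 * (n ^+ 2 + m) + al)) * m < 0.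
Proof.
rewrite /resolvent /quartic => t0_gt0 ft0 mE.
set c := t0 - al - 2 * n ^+ 2.
(* The identity behind this is [4 t0 m^2 = t0 c^2 + (2 t0 n + be)^2 - resolvent t0], whose last term
   is positive. It gives [|c| < 2 |m|], so [c - 2 m] has the sign of [- m]. *)
have c2 : c ^+ 2 < 4 * m ^+ 2.
  rewrite -(ltr_pM2l t0_gt0) mE /c.
  have := sqr_ge0 (2 * t0 * n + be); nra.
have -> : (t0 - (2 * (n ^+ 2 + m) + al)) = c - 2 * m by rewrite /c; ring.
case: (ltrgtP m 0) => m0; [nra|nra|].
by move: c2; rewrite m0 => c2; nra.
Qed.

(* The parabola [m = - n^2 + p n + q] through [P1] and [P2] meets the quartic
   again at [(n3, - m3)], and [P1 + P2 = (n3, m3)].  The coefficients are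
   expressed through [b], the [n]-coordinate of [- P2], so that the two
   conditions on [p] also cover the tangent case. *)
Lemma chord_core (F : realFieldType) (t0 n1 n2 b r2 p t2 : F) :
  let al := t2 - 2 * r2 in let be := - (n2 + b) * t2 in
  let ga := r2 ^+ 2 + n2 * b * t2 in
  let r1 := r2 + p * (n1 - n2) in
  let n3 := p / 2 - (2 * r1 + al) / (2 * p) - n2 in
  let m3 := n3 ^+ 2 - p * n3 - (r1 - p * n1) in
  0 < t0 -> resolvent al be ga t0 < 0 -> p != 0 ->
  p * (r1 + r2 - 2 * n1 ^+ 2) = (n1 - b) * t2 ->
  m3 ^+ 2 = quartic al be ga n3 /\
  (0 < (r1 - n1 ^+ 2) * (r2 - n2 ^+ 2) -> 0 < m3).
Proof.
move=> al be ga r1 n3 m3 t0_gt0 ft0 p0 rel.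
pose q := r2 - p * n2.
have n3E : 2 * p * n3 = p ^+ 2 - (2 * r1 + al) - 2 * p * n2.
  by rewrite /n3; field.
have m3q : m3 = - (p * n3 + q - n3 ^+ 2) by rewrite /m3 /q /r1; ring.
clearbody n3 m3.
(* [c2], [c1] and [c0] match the coefficients of [n^2], [n] and [1] in the factorization [id] below;
   [rel] enters through the last two. *)
have c2 : p ^+ 2 - 2 * q - al = 2 * p * (n1 + n2 + n3).
  by apply: (eq_of_cert (k := -1)) n3E; rewrite /q /r1; ring.
have c1 : 2 * p * q - be = - (2 * p * n1 * n2 + (n1 + n2) * (2 * p * n3)).
  by rewrite n3E; apply: (eq_of_cert (k := 1)) rel; rewrite /q /r1 /al /be /r1; ring.
have c0 : q ^+ 2 - ga = n1 * n2 * (2 * p * n3).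
  by rewrite n3E; apply: (eq_of_cert (k := - n2)) rel; rewrite /q /r1 /al /ga /r1; ring.
have id n : (p * n + q - n ^+ 2) ^+ 2 - quartic al be ga n =
    - 2 * p * (n - n1) * (n - n2) * (n - n3).
  have -> : al = p ^+ 2 - 2 * q - 2 * p * (n1 + n2 + n3) by rewrite -c2; ring.
  have -> : be = 2 * p * q + (2 * p * n1 * n2 + (n1 + n2) * (2 * p * n3)).
    by move: c1 => /eqP; rewrite subr_eq => /eqP ->; ring.
  have -> : ga = q ^+ 2 - n1 * n2 * (2 * p * n3) by rewrite -c0; ring.
  by rewrite /quartic; ring.
have m3E : m3 ^+ 2 = quartic al be ga n3.
  by apply/eqP; rewrite -subr_eq0 m3q sqrrN id subrr mulr0.
split=> // m12.
have e1 : (r1 - n1 ^+ 2) ^+ 2 = quartic al be ga n1.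
  apply/eqP; rewrite -subr_eq0.
  have -> : r1 - n1 ^+ 2 = p * n1 + q - n1 ^+ 2 by rewrite /r1 /q; ring.
  by rewrite id subrr mulr0 !mul0r.
have e2 : (r2 - n2 ^+ 2) ^+ 2 = quartic al be ga n2.
  by rewrite /quartic /al /be /ga; ring.
have s1 := component_sign t0_gt0 ft0 e1.
have s2 := component_sign t0_gt0 ft0 e2.
have s3 := component_sign t0_gt0 ft0 m3E.
have s3' := component_sign t0_gt0 ft0 (n := n3) (m := - m3).
rewrite sqrrN in s3'; have {}s3' := s3' m3E.
set t1 := 2 * (n1 ^+ 2 + (r1 - n1 ^+ 2)) + al in s1.
set u2 := 2 * (n2 ^+ 2 + (r2 - n2 ^+ 2)) + al in s2.
set t3 := 2 * (n3 ^+ 2 + - m3) + al in s3'.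
(* In the coordinates [(t, s)] the parabola is [p s = t (t - al - 2 q) + p be]. *)
have G : (t0 * (t0 - al - 2 * q) + p * be) ^+ 2 - p ^+ 2 * resolvent al be ga t0 =
  t0 * (t0 - t1) * (t0 - u2) * (t0 - t3).
  have -> : t3 = 2 * (p * n3 + q) + al by rewrite /t3 m3q; ring.
  have -> : t1 = 2 * (p * n1 + q) + al by rewrite /t1 /r1 /q; ring.
  have -> : u2 = 2 * (p * n2 + q) + al by rewrite /u2 /q; ring.
  have -> : al = p ^+ 2 - 2 * q - 2 * p * (n1 + n2 + n3) by rewrite -c2; ring.
  have -> : be = 2 * p * q + (2 * p * n1 * n2 + (n1 + n2) * (2 * p * n3)).
    by move: c1 => /eqP; rewrite subr_eq => /eqP ->; ring.
  have -> : ga = q ^+ 2 - n1 * n2 * (2 * p * n3) by rewrite -c0; ring.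
  by rewrite /resolvent; ring.
(* Positivity comes from the negative resolvent at [t0]. Since [m12] gives [t0 - t1] and [t0 - u2]
   the same sign, it follows that [t3 < t0], which forces [- m3 < 0]. *)
have Gpos : 0 < t0 * (t0 - t1) * (t0 - u2) * (t0 - t3).
  rewrite -G; have p2 : 0 < p ^+ 2 by rewrite exprn_even_gt0.
  have := sqr_ge0 (t0 * (t0 - al - 2 * q) + p * be); nra.
have tt : 0 < (t0 - t1) * (t0 - u2).
  have : 0 < ((t0 - t1) * (t0 - u2)) * ((r1 - n1 ^+ 2) * (r2 - n2 ^+ 2)).
    have := mulr_gt0 (x := - ((t0 - t1) * (r1 - n1 ^+ 2))) (y := - ((t0 - u2) * (r2 - n2 ^+ 2))).
    rewrite !oppr_gt0 => /(_ s1 s2); congr (0 < _); ring.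
  by rewrite pmulr_lgt0.
have : 0 < t0 - t3.
  move: Gpos; rewrite -!mulrA pmulr_rgt0 // mulrA pmulr_rgt0 //.
move: s3' => + h; rewrite pmulr_rlt0 //; lra.
Qed.

Lemma component_gt (F : realFieldType) (al be ga t0 n m : F) :
  0 < t0 -> resolvent al be ga t0 < 0 -> m ^+ 2 = quartic al be ga n ->
  0 < m -> t0 < 2 * (n ^+ 2 + m) + al.
Proof.
move=> t0_gt0 ft0 mE m_gt0; have := component_sign t0_gt0 ft0 mE.
by rewrite pmulr_llt0 // subr_lt0.
Qed.

(** The first condition on [p] is the slope of a chord with [n1 != n2]. The second one determines
    the tangent slope when the points coincide, and stays well conditioned when they are merely
    close. *)
Lemma add_point (F : realFieldType) (al be ga t0 n1 m1 n2 m2 p : F) :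
  let t2 := 2 * (n2 ^+ 2 + m2) + al in
  let r1 := n1 ^+ 2 + m1 in let r2 := n2 ^+ 2 + m2 in
  let n3 := p / 2 - (2 * r1 + al) / (2 * p) - n2 in
  let m3 := n3 ^+ 2 - p * n3 - (r1 - p * n1) in
  0 < t0 -> resolvent al be ga t0 < 0 -> p != 0 -> t2 != 0 ->
  m2 ^+ 2 = quartic al be ga n2 -> 0 < m1 * m2 ->
  p * (n1 - n2) = r1 - r2 ->
  p * (r1 + r2 - 2 * n1 ^+ 2) = (n1 + n2 + be / t2) * t2 ->
  m3 ^+ 2 = quartic al be ga n3 /\ 0 < m3.
Proof.
move=> t2 r1 r2 n3 m3 t0_gt0 ft0 p0 t20 e2 m12 h1 h2.
set b := - n2 - be / t2.
have alE : al = t2 - 2 * r2 by rewrite /t2 /r2; ring.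
have beE : be = - (n2 + b) * t2 by rewrite /b; field.
have gaE : ga = r2 ^+ 2 + n2 * b * t2.
  have -> : n2 * b * t2 = - n2 ^+ 2 * t2 - be * n2 by rewrite beE; ring.
  apply: (eq_of_cert (k := -1)) e2; rewrite /quartic /t2 /r2; ring.
have r1E : r1 = r2 + p * (n1 - n2) by rewrite h1; ring.
have := @chord_core F t0 n1 n2 b r2 p t2 t0_gt0.
rewrite -alE -beE -gaE -r1E => /(_ ft0 p0).
case.
  by rewrite h2 /b; field.
move=> q /(_ _); rewrite -/n3 -/m3 in q * => pos; split=> //; apply: pos.
have -> : r1 - n1 ^+ 2 = m1 by rewrite /r1; ring.
by have -> : r2 - n2 ^+ 2 = m2 by rewrite /r2; ring.
Qed.

(* The opposite point has the same [t]. *)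
Lemma neg_point (F : realFieldType) (al be ga t0 n m : F) :
  let b := - n - be / (2 * (n ^+ 2 + m) + al) in
  let m' := n ^+ 2 + m - b ^+ 2 in
  0 < t0 -> resolvent al be ga t0 < 0 ->
  m ^+ 2 = quartic al be ga n -> 0 < m ->
  m' ^+ 2 = quartic al be ga b /\ 0 < m'.
Proof.
move=> b m' t0_gt0 ft0 mE m_gt0.
have tgt := component_gt t0_gt0 ft0 mE m_gt0.
set t := 2 * (n ^+ 2 + m) + al in b m' tgt *.
have t0' : t != 0 by rewrite gt_eqF // (lt_trans t0_gt0).
have bE : be = - (n + b) * t by rewrite /b; field.
have m'E : m' ^+ 2 = quartic al be ga b.
  apply: (eq_of_cert (k := 1)) mE; rewrite bE /quartic /m' /t; clear; ring.
split=> //; have := component_sign t0_gt0 ft0 m'E.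
have -> : 2 * (b ^+ 2 + m') + al = t by rewrite /m' /t; ring.
by rewrite nmulr_rlt0 // subr_lt0.
Qed.

(** * Bounds on the component [m > 0] and small translations *)

(** The right side minus the left side is [t0 (t0 - al - 2 n^2)^2 + (2 t0 n + be)^2]. A negative
    resolvent thus keeps the quartic away from 0. *)
Lemma quartic_lbound (F : realFieldType) (al be ga t0 n m : F) :
  0 < t0 -> m ^+ 2 = quartic al be ga n ->
  - resolvent al be ga t0 <= 4 * t0 * m ^+ 2.
Proof.
move=> t0_gt0 mE; rewrite mE.
have := sqr_ge0 (2 * t0 * n + be).
have := mulr_ge0 (ltW t0_gt0) (sqr_ge0 (t0 - al - 2 * n ^+ 2)).
rewrite /resolvent /quartic; lra.
Qed.

Lemma component_lbound (F : realFieldType) (al be ga t0 : F) :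
  0 < t0 -> resolvent al be ga t0 < 0 ->
  exists2 mu, 0 < mu & forall n m, m ^+ 2 = quartic al be ga n -> 0 < m -> mu <= m.
Proof.
move=> t0_gt0 ft0; set c := - resolvent al be ga t0 / (4 * t0).
have c_gt0 : 0 < c by rewrite divr_gt0 ?oppr_gt0 // mulr_gt0.
(* The minimum with 1 avoids a square root: if [m < 1], then [c <= m^2 <= m]. *)
exists (Num.min 1 c); first by rewrite lt_min ltr01.
move=> n m mE m_gt0; have := quartic_lbound t0_gt0 mE.
rewrite -ler_pdivrMl ?mulr_gt0 // mulrC -/c => cm.
rewrite ge_min; case: (lerP 1 m) => //= m1; nra.
Qed.

Lemma quartic_ubound (F : realFieldType) (al be ga B n m : F) :
  1 <= B -> `|n| <= B -> m ^+ 2 = quartic al be ga n ->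
  m <= B ^+ 4 * (1 + (`|al| + `|be| + `|ga|)) + 1.
Proof.
move=> B1 nB mE; set K := `|al| + _ + _.
have : quartic al be ga n <= B ^+ 4 * (1 + K).
  apply: le_trans (ler_norm _) _; rewrite /quartic.
  apply: le_trans (ler_normD _ _) _; rewrite /K !mulrDr mulr1 addrA.
  have B0 : 0 <= B by lra.
  have le4 k : (k <= 4)%N -> `|n| ^+ k <= B ^+ 4.
    move=> k4; apply: le_trans (_ : B ^+ k <= _); first by rewrite lerXn2r ?nnegrE.
    by rewrite ler_weXn2l.
  apply: lerD; last by rewrite ler_peMl // exprn_ege1.
  apply: le_trans (ler_normD _ _) _; rewrite addrA; apply: lerD; last first.
    by rewrite normrM mulrC ler_wpM2r // (le4 1%N).
  apply: le_trans (ler_normD _ _) _; apply: lerD; first by rewrite normrX le4.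
  by rewrite normrM normrX mulrC ler_wpM2r // le4.
rewrite -mE; nra.
Qed.

(** A point with large [N] is near the neutral element at infinity, so adding it moves each [n] of a
    bounded range down by at most [eta]. The uniform lower bound [d], which may depend on [N], lets
    finitely many steps cover a given distance. *)
Lemma small_step (F : realFieldType) (al be ga t0 M eta : F) :
  0 < t0 -> resolvent al be ga t0 < 0 -> 0 < eta ->
  exists N0, forall N mN, mN ^+ 2 = quartic al be ga N -> 0 < mN -> N0 <= N ->
  exists2 d, 0 < d & forall n m, m ^+ 2 = quartic al be ga n -> 0 < m -> `|n| <= M ->
  exists n' m', [/\ m' ^+ 2 = quartic al be ga n', 0 < m', n' + d <= n
    & n <= n' + eta].
Proof.
move=> t0_gt0 ft0 eta_gt0.
pose K := `|al| + `|be| + `|ga|; pose B := `|M| + 1.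
have [a0 b0 g0] : [/\ 0 <= `|al|, 0 <= `|be| & 0 <= `|ga|] by [].
have K0 : 0 <= K by rewrite /K; lra.
have B1 : 1 <= B by rewrite /B; have := normr_ge0 M; lra.
pose C := B ^+ 4 * (1 + K) + 1.
have C0 : 0 <= C by rewrite /C; have := exprn_ge0 4 (le_trans ler01 B1); nra.
pose E := 2 * (C + B ^+ 2) + K + 1.
have B20 := sqr_ge0 B.
have E0 : 1 <= E by rewrite /E; lra.
have Ee0 : 0 < E / eta by rewrite divr_gt0 //; lra.
have [mu mu0 mumin] := component_lbound t0_gt0 ft0.
exists (3 * B + E + E / eta + 1 + eta) => N mN mNE mN_gt0 N_ge.
(* By [key] below, the step times a factor of at most [2 N + 1 + eta] equals [m + m3], which is at
   least [mu]. *)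
exists (mu / (2 * N + 1 + eta)); first by rewrite divr_gt0 //; lra.
move=> n m mE m_gt0 nM.
have nB : `|n| <= B by rewrite /B; have := ler_norm M; lra.
have [nB1 nB2] : - B <= n /\ n <= B by apply/andP; rewrite -ler_norml.
have mC : m <= C by exact: quartic_ubound mE.
have nn : n ^+ 2 <= B ^+ 2 by nra.
pose k1 := m - n ^+ 2; pose k2 := mN - N ^+ 2; pose D := N - n.
have k1b : `|k1| <= C + B ^+ 2 by rewrite ler_norml /k1; have := sqr_ge0 n; lra.
have k2b : `|k2| <= K.
  have N2 : 1 <= N ^+ 2 by nra.
  have k2E : k2 * (mN + N ^+ 2) = al * N ^+ 2 + be * N + ga.
    by rewrite /k2; apply: (eq_of_cert (k := 1)) mNE; rewrite /quartic; ring.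
  have pos : 0 < mN + N ^+ 2 by lra.
  rewrite -(ler_pM2r pos) -{1}(gtr0_norm pos) -normrM k2E.
  apply: le_trans (_ : K * N ^+ 2 <= _); last by rewrite ler_wpM2l //; lra.
  apply: le_trans (ler_normD _ _) _; rewrite /K mulrDl; apply: lerD; last by rewrite ler_peMr.
  apply: le_trans (ler_normD _ _) _; rewrite mulrDl; apply: lerD.
    by rewrite normrM (ger0_norm (sqr_ge0 N)).
  by rewrite normrM ler_wpM2l // ger0_norm; nra.
have D_ge : E + E / eta + 1 <= D by rewrite /D; lra.
have D_gt0 : 0 < D by lra.
(* [p] is the chord slope. As [m] and [mN] differ from [n^2] and [N^2] by the bounded [k1] and [k2],
   it is [2 N + 2 n] up to an error [e] of order [1 / D]. *)
pose e := (k2 - k1) / D; pose p := 2 * N + 2 * n + e.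
have eb : `|e| <= E / D.
  rewrite /e normrM normfV (gtr0_norm D_gt0) ler_pM2r ?invr_gt0 //.
  apply: le_trans (ler_normB _ _) _; rewrite /E; lra.
have ED1 : E / D <= 1 by rewrite ler_pdivrMr // mul1r; lra.
have EDeta : E / D <= eta.
  by rewrite ler_pdivrMr // mulrC -ler_pdivrMr //; lra.
have [e1 e2] : - (E / D) <= e /\ e <= E / D by apply/andP; rewrite -ler_norml.
have pD : D <= p by rewrite /p /D; lra.
have p_gt0 : 0 < p by lra.
have t2gt := component_gt t0_gt0 ft0 mNE mN_gt0.
have t20 : 2 * (N ^+ 2 + mN) + al != 0 by rewrite gt_eqF // (lt_trans t0_gt0).
have h1 : p * (n - N) = n ^+ 2 + m - (N ^+ 2 + mN).
  rewrite /p /e /k1 /k2 /D; field; apply: lt0r_neq0; exact: D_gt0.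
have nN : n - N != 0 by rewrite -opprB oppr_eq0 lt0r_neq0.
(* After multiplication by the nonzero [n - N], this is the difference of the two curve
   equations. *)
have h2 : p * (n ^+ 2 + m + (N ^+ 2 + mN) - 2 * n ^+ 2) =
    (n + N + be / (2 * (N ^+ 2 + mN) + al)) * (2 * (N ^+ 2 + mN) + al).
  apply: (mulIf nN); rewrite mulrAC h1.
  have -> : (n + N + be / (2 * (N ^+ 2 + mN) + al)) * (2 * (N ^+ 2 + mN) + al) =
     (n + N) * (2 * (N ^+ 2 + mN) + al) + be by field.
  apply/eqP; rewrite -subr_eq0.
  have -> : (n ^+ 2 + m - (N ^+ 2 + mN)) * (n ^+ 2 + m + (N ^+ 2 + mN) - 2 * n ^+ 2) -
     ((n + N) * (2 * (N ^+ 2 + mN) + al) + be) * (n - N) =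
     (m ^+ 2 - quartic al be ga n) - (mN ^+ 2 - quartic al be ga N).
    by rewrite /quartic; ring.
  by rewrite mE mNE !subrr.
have m12 : 0 < m * mN by exact: mulr_gt0.
have [m3E m3_gt0] := add_point t0_gt0 ft0 (lt0r_neq0 p_gt0) t20 mNE m12 h1 h2.
set n3 := p / 2 - _ - N in m3E m3_gt0; set m3 := n3 ^+ 2 - _ - _ in m3E m3_gt0.
have xE : n - n3 = - e / 2 + (2 * (n ^+ 2 + m) + al) / (2 * p).
  by rewrite /n3 {1}/p; field; apply: lt0r_neq0.
have tb : `|(2 * (n ^+ 2 + m) + al) / (2 * p)| <= E / D / 2.
  rewrite normrM normfV (gtr0_norm (_ : 0 < 2 * p)) ?mulr_gt0 //.
  rewrite -mulrA -invfM; apply: ler_pM => //; first by rewrite invr_ge0; lra.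
    apply: le_trans (ler_normD _ _) _; rewrite ger0_norm; last by have := sqr_ge0 n; lra.
    by rewrite /E /K; lra.
  by rewrite lef_pV2 ?posrE; lra.
have [tb1 tb2] : - (E / D / 2) <= (2 * (n ^+ 2 + m) + al) / (2 * p) /\
   (2 * (n ^+ 2 + m) + al) / (2 * p) <= E / D / 2 by apply/andP; rewrite -ler_norml.
have x1 : n - n3 <= eta by rewrite xE; lra.
have x2 : - eta <= n - n3 by rewrite xE; lra.
(* This factorization gives the sign of the step. *)
have key : m + m3 = (n - n3) * (2 * N + e + (n - n3)).
  by rewrite /m3 /p; ring.
exists n3, m3; split=> //; last by lra.
have fac : 0 < 2 * N + e + (n - n3) by lra.
rewrite -lerBrDl ler_pdivrMr; last by lra.
have x0 : 0 < n - n3 by rewrite -(pmulr_lgt0 _ fac) -key addr_gt0.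
have mum := mumin _ _ mE m_gt0.
apply: le_trans (_ : (n - n3) * (2 * N + e + (n - n3)) <= _); first by rewrite -key; lra.
by rewrite ler_pM2l //; lra.
Qed.

(** * Density of an infinite group of points *)

(** The point found is [P1 - P2]. Its slope [p] is small when [n1] and [n2] are close, and in
    [n3 = p / 2 - t1 / (2 p) - b] the middle term then dominates, because [t1 > t0]. *)
Lemma close_points (F : realFieldType) (al be ga t0 B L : F) :
  0 < t0 -> resolvent al be ga t0 < 0 ->
  exists2 d, 0 < d & forall n1 m1 n2 m2,
    m1 ^+ 2 = quartic al be ga n1 -> 0 < m1 ->
    m2 ^+ 2 = quartic al be ga n2 -> 0 < m2 ->
    `|n1| <= B -> `|n2| <= B -> n1 != n2 -> `|n1 - n2| < d ->
  exists n m, [/\ m ^+ 2 = quartic al be ga n, 0 < m & L <= `|n|].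
Proof.
move=> t0_gt0 ft0.
have [mu mu0 mumin] := component_lbound t0_gt0 ft0.
have [a0 b0 g0] : [/\ 0 <= `|al|, 0 <= `|be| & 0 <= `|ga|] by [].
pose b' := `|B| + 1; have b'1 : 1 <= b' by rewrite /b'; have := normr_ge0 B; lra.
have b'B : B <= b' by rewrite /b'; have := ler_norm B; lra.
pose C := b' ^+ 4 * (1 + (`|al| + `|be| + `|ga|)) + 1.
have C0 : 0 <= C.
  by rewrite addr_ge0 // mulr_ge0 ?exprn_ge0 ?addr_ge0 // (le_trans ler01).
pose T := 2 * (b' ^+ 2 + C) + `|al| + 1.
have T0 : 0 < T by rewrite /T; have := sqr_ge0 b'; lra.
have bt0 : 0 <= `|be| / t0 by rewrite divr_ge0 // ltW.
pose G := `|L| + 1 + b' + `|be| / t0.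
have G0 : 0 < G by rewrite /G; have := normr_ge0 L; lra.
pose P := Num.min 1 (t0 / (2 * G)).
have P0 : 0 < P by rewrite lt_min ltr01 divr_gt0 // mulr_gt0.
have P1 : P <= 1 by rewrite ge_min lexx.
have PG : P * (2 * G) <= t0.
  by rewrite -ler_pdivlMr ?mulr_gt0 // ge_min lexx orbT.
exists (Num.min (mu / (2 * b')) (P * mu / T)).
  by rewrite lt_min !divr_gt0 ?mulr_gt0 //; lra.
move=> n1 m1 n2 m2 m1E m1_gt0 m2E m2_gt0 n1B n2B n12.
rewrite lt_min => /andP[d1 d2].
have {}n1B := le_trans n1B b'B; have {}n2B := le_trans n2B b'B.
have t1gt := component_gt t0_gt0 ft0 m1E m1_gt0.
have t2gt := component_gt t0_gt0 ft0 m2E m2_gt0.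
have [bE b_gt0] := neg_point t0_gt0 ft0 m2E m2_gt0.
set t2 := 2 * (n2 ^+ 2 + m2) + al in t2gt bE b_gt0.
set t1 := 2 * (n1 ^+ 2 + m1) + al in t1gt.
set b := - n2 - be / t2 in bE b_gt0; set mb := n2 ^+ 2 + m2 - b ^+ 2 in bE b_gt0.
have t2_gt0 : 0 < t2 by exact: lt_trans t2gt.
(* [w] is the coefficient of [p] in the second slope condition for [P1] and [- P2]. It stays above
   [mu], so that condition can be solved for [p]. *)
pose w := m1 + m2 - (n1 - n2) * (n1 + n2).
have w_ge : mu <= w.
  have M1 := mumin _ _ m1E m1_gt0; have M2 := mumin _ _ m2E m2_gt0.
  have : `|(n1 - n2) * (n1 + n2)| <= mu.
    rewrite normrM; apply: le_trans (_ : mu / (2 * b') * (2 * b') <= _).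
      apply: ler_pM => //; first exact: ltW.
      by apply: le_trans (ler_normD _ _) _; clear -n1B n2B; lra.
    by rewrite divfK //; apply: lt0r_neq0; clear -b'1; lra.
  by move=> /(le_trans (ler_norm _)); rewrite /w; clear -M1 M2; lra.
have w_gt0 : 0 < w by exact: lt_le_trans w_ge.
pose p := (n1 - n2) * t2 / w.
have p0 : p != 0.
  have n12' : n1 - n2 != 0 by rewrite subr_eq0.
  by rewrite !mulf_neq0 ?invr_neq0 // lt0r_neq0.
have rE : n2 ^+ 2 + m2 = b ^+ 2 + mb by rewrite /mb; ring.
have tE : 2 * (b ^+ 2 + mb) + al = t2 by rewrite -rE.
have h1 : p * (n1 - b) = n1 ^+ 2 + m1 - (b ^+ 2 + mb).
  rewrite -rE; apply: (mulIf (lt0r_neq0 w_gt0)).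
  have -> : p * (n1 - b) * w = (n1 - n2) * ((n1 + n2) * t2 + be).
    by rewrite /p /b; field; rewrite !lt0r_neq0.
  apply/eqP; rewrite -subr_eq0.
  have -> : (n1 - n2) * ((n1 + n2) * t2 + be) - (n1 ^+ 2 + m1 - (n2 ^+ 2 + m2)) * w =
     (m2 ^+ 2 - quartic al be ga n2) - (m1 ^+ 2 - quartic al be ga n1).
    by rewrite /quartic /w /t2; ring.
  by rewrite m1E m2E !subrr.
have h2 : p * (n1 ^+ 2 + m1 + (b ^+ 2 + mb) - 2 * n1 ^+ 2) =
    (n1 + b + be / (2 * (b ^+ 2 + mb) + al)) * (2 * (b ^+ 2 + mb) + al).
  rewrite tE -rE.
  have -> : n1 ^+ 2 + m1 + (n2 ^+ 2 + m2) - 2 * n1 ^+ 2 = w by rewrite /w; ring.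
  by rewrite /p divfK ?lt0r_neq0 // /b; congr (_ * _); ring.
have t20 : 2 * (b ^+ 2 + mb) + al != 0 by rewrite tE lt0r_neq0.
have [m3E m3_gt0] := add_point t0_gt0 ft0 p0 t20 bE (mulr_gt0 m1_gt0 b_gt0) h1 h2.
set n3 := p / 2 - _ - b in m3E m3_gt0; set m3 := n3 ^+ 2 - _ - _ in m3E m3_gt0.
exists n3, m3; split=> //.
have pP : `|p| <= P.
  rewrite /p 2!normrM normfV (gtr0_norm w_gt0) (gtr0_norm t2_gt0).
  rewrite ler_pdivrMr //; apply: le_trans (_ : P * mu <= _); last by rewrite ler_pM2l.
  apply: le_trans (_ : P * mu / T * T <= _); last by rewrite divfK // lt0r_neq0.
  apply: ler_pM => //; [exact: ltW|exact: ltW|].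
  have mC : m2 <= C by exact: quartic_ubound m2E.
  have nn : n2 ^+ 2 <= b' ^+ 2 by rewrite -(real_normK (num_real n2)) lerXn2r ?nnegrE //; clear -b'1; lra.
  have := ler_norm al; rewrite /t2 /T; clear -mC nn; lra.
have bb : `|b| <= b' + `|be| / t0.
  apply: le_trans (ler_normB _ _) _; rewrite normrN; apply: lerD => //.
  rewrite normrM normfV (gtr0_norm t2_gt0); apply: ler_wpM2l => //.
  by rewrite lef_pV2 ?posrE // ltW.
have np : 0 < `|p| by rewrite normr_gt0.
have big : G <= `|t1 / (2 * p)|.
  rewrite normrM normfV normrM (gtr0_norm (lt_trans t0_gt0 t1gt)) (ger0_norm (_ : 0 <= 2)) //.
  rewrite ler_pdivlMr ?mulr_gt0 //.
  apply: le_trans (ltW t1gt); apply: le_trans PG.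
  by have := ler_wpM2l (ltW G0) pP; clear; lra.
have : `|t1 / (2 * p)| <= `|n3| + `|p| / 2 + `|b|.
  have -> : t1 / (2 * p) = - n3 + p / 2 + - b by rewrite /n3 -/t1; ring.
  apply: le_trans (ler_normD _ _) _; rewrite normrN lerD2r.
  apply: le_trans (ler_normD _ _) _; rewrite normrN lerD2l normrM normfV.
  by rewrite (ger0_norm (_ : 0 <= 2)).
have := ler_norm L; move: big bb pP P1; rewrite /G; clear; lra.
Qed.

(** If [n] is very negative, the opposite point has abscissa [- n - be / t], and [be / t] is bounded
    because [t > t0]. *)
Lemma large_point (F : realFieldType) (al be ga t0 L n m : F) :
  0 < t0 -> resolvent al be ga t0 < 0 ->
  m ^+ 2 = quartic al be ga n -> 0 < m -> L + `|be| / t0 <= `|n| ->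
  exists n' m', [/\ m' ^+ 2 = quartic al be ga n', 0 < m' & L <= n'].
Proof.
move=> t0_gt0 ft0 mE m_gt0.
have tgt := component_gt t0_gt0 ft0 mE m_gt0.
have [bE b_gt0] := neg_point t0_gt0 ft0 mE m_gt0.
set t := 2 * (n ^+ 2 + m) + al in tgt bE b_gt0.
have bt0 : 0 <= `|be| / t0 by rewrite divr_ge0 // ltW.
have [n0|n0] := lerP 0 n.
  by rewrite (ger0_norm n0) => nL; exists n, m; split=> //; lra.
rewrite (ltr0_norm n0) => nL; exists (- n - be / t), (n ^+ 2 + m - (- n - be / t) ^+ 2).
split=> //.
have : `|be / t| <= `|be| / t0.
  rewrite normrM normfV (gtr0_norm (lt_trans t0_gt0 tgt)) ler_wpM2l //.
  by rewrite lef_pV2 ?posrE ?(lt_trans t0_gt0 tgt) // ltW.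
have := ler_norm (be / t); lra.
Qed.

Lemma pigeonhole (F : archiRealFieldType) (B d : F) (x : nat -> F) :
  0 < d -> (forall i, `|x i| <= B) -> exists i j, i != j /\ `|x i - x j| < d.
Proof.
move=> d0 xB; pose g i := Num.truncn ((x i + B) / d).
have pos i : 0 <= (x i + B) / d.
  rewrite divr_ge0 ?(ltW d0) //; have := xB i; rewrite ler_norml => /andP[]; lra.
pose K := Num.bound (2 * B / d).
have gK i : (g i < K)%N.
  rewrite -(ltr_nat F); apply: le_lt_trans (_ : (x i + B) / d < _).
    by have /andP[] := truncn_itv (pos i).
  apply: le_lt_trans (archi_boundP _).
    by rewrite ler_pM2r ?invr_gt0 //; have := xB i; rewrite ler_norml => /andP[]; lra.
  rewrite divr_ge0 ?(ltW d0) //; have := le_trans (normr_ge0 _) (xB 0%N); lra.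
have /injectivePn [i [j ij gij]] : ~~ injectiveb (fun i : 'I_K.+1 => Ordinal (gK i)).
  by apply/negP => /injectiveP /leq_card; rewrite !card_ord ltnn.
exists (val i), (val j); split=> //; case: gij => gij.
have /andP[i1 i2] := truncn_itv (pos i); have /andP[j1 j2] := truncn_itv (pos j).
rewrite -/(g i) in i1 i2; rewrite -/(g j) -gij in j1 j2.
move: i1 i2 j1 j2; rewrite !ler_pdivlMr // !ltr_pdivrMr // -natr1 !mulrDl mul1r.
by move=> *; rewrite ltr_norml; apply/andP; split; lra.
Qed.

(** Either some given point is already far out, or all of them lie in a bounded range and two are
    close, so that their difference is far out. *)
Lemma unbounded_points (F : archiRealFieldType) (al be ga t0 : F) (x y : nat -> F) :
  0 < t0 -> resolvent al be ga t0 < 0 -> injective x ->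
  (forall i, y i ^+ 2 = quartic al be ga (x i) /\ 0 < y i) ->
  forall L, exists n m, [/\ m ^+ 2 = quartic al be ga n, 0 < m & L <= n].
Proof.
move=> t0_gt0 ft0 x_inj xy L; pose B := L + `|be| / t0.
have [[i iB]|nB] := boolp.pselect (exists i, B <= `|x i|).
  by have [yE y_gt0] := xy i; exact: large_point yE y_gt0 iB.
have xB i : `|x i| <= B.
  by rewrite leNgt; apply/negP => h; apply: nB; exists i; exact: ltW.
have [d d_gt0 dP] := close_points B B t0_gt0 ft0.
have [i [j [ij xij]]] := pigeonhole d_gt0 xB.
have [yi yi0] := xy i; have [yj yj0] := xy j.
have xne : x i != x j by apply: contra ij => /eqP /x_inj ->.
have [n [m [mE m_gt0 nB']]] := dP _ _ _ _ yi yi0 yj yj0 (xB i) (xB j) xne xij.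
exact: large_point mE m_gt0 nB'.
Qed.

(** Starting from a point beyond [d], repeated small translations descend until they enter the
    interval; steps of at most [(d - c) / 2] cannot jump over it. *)
Lemma dense_points (F : archiRealFieldType) (al be ga t0 c d : F) :
  0 < t0 -> resolvent al be ga t0 < 0 ->
  (forall L, exists n m, [/\ m ^+ 2 = quartic al be ga n, 0 < m & L <= n]) ->
  c < d -> exists n m, [/\ m ^+ 2 = quartic al be ga n, 0 < m, c < n & n < d].
Proof.
move=> t0_gt0 ft0 large cd.
have [n0 [m0 [m0E m0_gt0 n0d]]] := large d.
pose M := `|c| + `|n0|.
have dc0 : 0 < (d - c) / 2 by lra.
have [N0 N0P] := small_step M t0_gt0 ft0 dc0.
have [N [mN [mNE mN_gt0 NN]]] := large N0.
have [e e0 step] := N0P _ _ mNE mN_gt0 NN.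
(* [k] bounds the number of steps of length at least [e] still needed to get below [d]. *)
suff descend k n m : m ^+ 2 = quartic al be ga n -> 0 < m -> c < n -> n <= n0 ->
    n < d + k%:R * e ->
    exists n m, [/\ m ^+ 2 = quartic al be ga n, 0 < m, c < n & n < d].
  apply: (descend (Num.bound ((n0 - d) / e)) n0 m0) => //; first by lra.
  rewrite -ltrBlDl -ltr_pdivrMr //; apply: archi_boundP.
  by rewrite divr_ge0 ?(ltW e0) //; lra.
elim: k n m => [|k IHk] n m mE m_gt0 cn nn0 nk.
  by exists n, m; split=> //; rewrite mul0r addr0 in nk.
have [nd|dn] := ltrP n d; first by exists n, m.
have nM : `|n| <= M.
  have := ler_norm n0; have := normr_ge0 n0; have := ler_norm (- c).
  have := normr_ge0 c; rewrite normrN /M ler_norml => *; apply/andP; split; lra.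
have [n' [m' [m'E m'_gt0 n'1 n'2]]] := step _ _ mE m_gt0 nM.
apply: (IHk n' m') => //; [lra|lra|].
by move: nk; rewrite -natr1 mulrDl mul1r; lra.
Qed.

(** * Doubling and 2-adic valuations *)

(** Binary integers let [vm_compute] check the explicit points with large coordinates. *)
Definition rat_of_Z : Z -> rat := intr \o int_of_Z.
HB.instance Definition _ := GRing.RMorphism.copy rat_of_Z (intr \o int_of_Z : Z -> rat).

Arguments rat_of_Z _%_R.

Lemma rat_of_Z_inj : injective rat_of_Z.
Proof. by move=> x y /intr_inj /(can_inj int_of_ZK). Qed.

Lemma rat_of_ZM x y : rat_of_Z (x * y) = rat_of_Z x * rat_of_Z y.
Proof. exact: rmorphM. Qed.

(** This is the duplication formula of the Weierstrass model, in the abscissa [t]. The double lies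
    on [m' > 0] whichever the sign of [m], since [m * m > 0]. *)
Lemma double_point (F : realFieldType) (al be ga t0 n m : F) :
  let t := 2 * (n ^+ 2 + m) + al in
  0 < t0 -> resolvent al be ga t0 < 0 -> m ^+ 2 = quartic al be ga n ->
  m != 0 -> t != 0 -> resolvent al be ga t != 0 ->
  exists n' m', [/\ m' ^+ 2 = quartic al be ga n', 0 < m' &
    (2 * (n' ^+ 2 + m') + al) * (4 * resolvent al be ga t) =
      (t ^+ 2 - (al ^+ 2 - 4 * ga)) ^+ 2 - 8 * be ^+ 2 * (t - al)].
Proof.
move=> t t0_gt0 ft0 mE m0 tn0 rt0.
have gaE : ga = m ^+ 2 - (n ^+ 4 + al * n ^+ 2 + be * n).
  by rewrite mE /quartic; ring.
have rE : resolvent al be ga t = (2 * t * n + be) ^+ 2.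
  by rewrite /resolvent gaE /t; ring.
have s0 : 2 * t * n + be != 0 by apply: contraNneq rt0 => s0; rewrite rE s0 expr0n.
(* The tangent slope, solved from the second slope condition. *)
pose p := (2 * t * n + be) / (2 * m).
have p0 : p != 0.
  have m20 : 2 * m != 0 by rewrite mulf_neq0 // pnatr_eq0.
  by rewrite /p mulf_neq0 ?invr_neq0.
have h1 : p * (n - n) = (n ^+ 2 + m) - (n ^+ 2 + m) by rewrite !subrr mulr0.
have h2 : p * ((n ^+ 2 + m) + (n ^+ 2 + m) - 2 * n ^+ 2) = (n + n + be / t) * t.
  by rewrite /p; field; rewrite m0 tn0.
have mm : 0 < m * m by rewrite -expr2 exprn_even_gt0.
have [e pos] := add_point t0_gt0 ft0 p0 tn0 mE mm h1 h2.
eexists; eexists; split; [exact: e|exact: pos|].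
have tE : t = 2 * (n ^+ 2 + m) + al by [].
rewrite rE gaE -/t /p; have -> : al = t - 2 * (n ^+ 2 + m) by rewrite tE; ring.
clearbody t; field; rewrite s0 m0 //.
Qed.

(** The 2-adic valuation of [x] is [- k]. The odd witnesses need not be coprime, so fractions need
    not be reduced. *)
Definition has_val2 (k : nat) (x : rat) : Prop :=
  exists u w : Z, x * rat_of_Z (2 ^+ k * (2 * w + 1)) = rat_of_Z (2 * u + 1).

Lemma has_val2_inj (k l : nat) (x : rat) : has_val2 k x -> has_val2 l x -> k = l.
Proof.
wlog kl : k l / (k <= l)%N => [H|].
  by case: (leqP k l) => [|/ltnW] kl hk hl; [|symmetry]; apply: H.
move=> [u [w e]] [u' [w' e']].
have : rat_of_Z ((2 * u + 1) * (2 ^+ l * (2 * w' + 1))) =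
       rat_of_Z ((2 * u' + 1) * (2 ^+ k * (2 * w + 1))).
  by rewrite rat_of_ZM -e [RHS]rat_of_ZM -e'; ring.
move=> /rat_of_Z_inj; rewrite -(subnKC kl) exprD.
case: (l - k)%N => [|j]; first by rewrite addn0.
have k0 : (2 ^+ k : Z) != 0 by rewrite expf_neq0.
rewrite exprS => E; exfalso.
have {}E : (2 * u + 1) * (2 * 2 ^+ j * (2 * w' + 1)) = (2 * u' + 1) * (2 * w + 1).
  by apply: (mulfI k0); apply: etrans (etrans E _); ring.
move: (2 ^+ j : Z) E => y E.
lia.
Qed.

Definition cubic (K : comNzRingType) (c2 c4 c6 u w : K) : K :=
  u ^+ 3 + c2 * u ^+ 2 * w + c4 * u * w ^+ 2 + c6 * w ^+ 3.

(** Homogenized numerator of the duplication formula for [y^2 = x^3 + c2 x^2 + c4 x + c6]; the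
    matching denominator is [4 w] times [cubic]. *)
Definition dup (K : comNzRingType) (c2 c4 c6 u w : K) : K :=
  u ^+ 4 - 2 * c4 * u ^+ 2 * w ^+ 2 - 8 * c6 * u * w ^+ 3 +
  (c4 ^+ 2 - 4 * c2 * c6) * w ^+ 4.

Lemma dup_frac (c2 c4 c6 u w : Z) (x x' : rat) :
  let q := rat_of_Z in
  x * q w = q u -> x' * (4 * cubic (q c2) (q c4) (q c6) x 1) =
     dup (q c2) (q c4) (q c6) x 1 ->
  x' * q (4 * w * cubic c2 c4 c6 u w) = q (dup c2 c4 c6 u w).
Proof.
move=> q xw x'E.
have -> : q (4 * w * cubic c2 c4 c6 u w) =
    4 * q w * cubic (q c2) (q c4) (q c6) (q u) (q w).
  by rewrite /q /cubic; ring.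
have -> : q (dup c2 c4 c6 u w) = dup (q c2) (q c4) (q c6) (q u) (q w).
  by rewrite /q /dup; ring.
rewrite -xw.
have -> : dup (q c2) (q c4) (q c6) (x * q w) (q w) =
    q w ^+ 4 * dup (q c2) (q c4) (q c6) x 1 by rewrite /dup; ring.
by rewrite -x'E /cubic; ring.
Qed.

(** For an odd numerator and an even denominator [w], both [cubic] and [dup] take odd values. The
    new denominator [4 * w * cubic] thus gains exactly two factors 2. *)
Lemma has_val2_dup (c2 c4 c6 : Z) (k : nat) (x : rat) :
  let q := rat_of_Z in
  has_val2 k.+1 x -> x != 0 /\ cubic (q c2) (q c4) (q c6) x 1 != 0 /\
  forall x', x' * (4 * cubic (q c2) (q c4) (q c6) x 1) =
    dup (q c2) (q c4) (q c6) x 1 -> has_val2 k.+3 x'.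
Proof.
move=> q [u [w xw]].
have odd0 (z : Z) : q (2 * z + 1) != 0.
  apply/negP => /eqP E; have : 2 * z + 1 = 0 by apply: rat_of_Z_inj; apply: etrans E _; symmetry; exact: rmorph0.
  lia.
pose v : Z := (2 ^+ k * (2 * w + 1))%R.
have WE : 2 ^+ k.+1 * (2 * w + 1) = 2 * v by rewrite /v exprS mulrA.
have x0 : x != 0.
  by apply/negP => /eqP E; have := odd0 u; rewrite /q -xw E mul0r eqxx.
pose r : Z := (4 * u ^+ 3 + 6 * u ^+ 2 + 3 * u + c2 * (2 * u + 1) ^+ 2 * v +
  2 * c4 * (2 * u + 1) * v ^+ 2 + 4 * c6 * v ^+ 3)%R.
have rE : cubic c2 c4 c6 (2 * u + 1) (2 * v) = 2 * r + 1 by rewrite /cubic /r; ring.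
rewrite WE -/q in xw.
split=> //; split.
  apply/negP => /eqP E; have := odd0 r; rewrite -rE.
  have -> : q (cubic c2 c4 c6 (2 * u + 1) (2 * v)) =
     q (2 * v) ^+ 3 * cubic (q c2) (q c4) (q c6) x 1.
    have -> : q (cubic c2 c4 c6 (2 * u + 1) (2 * v)) =
      cubic (q c2) (q c4) (q c6) (q (2 * u + 1)) (q (2 * v)) by rewrite /q /cubic; ring.
    by rewrite -xw /cubic; ring.
  by rewrite E mulr0 eqxx.
move=> x' x'E; have := dup_frac xw x'E; rewrite rE.
pose u' : Z := (8 * u ^+ 4 + 16 * u ^+ 3 + 12 * u ^+ 2 + 4 * u -
  4 * c4 * (2 * u + 1) ^+ 2 * v ^+ 2 - 32 * c6 * (2 * u + 1) * v ^+ 3 +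
  8 * (c4 ^+ 2 - 4 * c2 * c6) * v ^+ 4)%R.
have -> : dup c2 c4 c6 (2 * u + 1) (2 * v) = 2 * u' + 1 by rewrite /dup /u'; ring.
have -> : 4 * (2 * v) * (2 * r + 1) = 2 ^+ k.+3 * (2 * (2 * w * r + w + r) + 1).
  by rewrite /v !exprS; ring.
by exists u', (2 * w * r + w + r).
Qed.

Lemma resolvent_cubic (F : comNzRingType) (A B C D x : F) :
  4 * x * ((4 * x - (- (2 * A))) ^+ 2 - 4 * (A ^+ 2 + 4 * B * C)) + (- (32 * B * D)) ^+ 2 =
    64 * cubic A (- (B * C)) ((4 * B * D) ^+ 2) x 1.
Proof. by rewrite /cubic; ring. Qed.

Lemma double_dup (F : realFieldType) (A B C D t0 n m x : F) :
  let al := - (2 * A) in let be := - (32 * B * D) in let ga := A ^+ 2 + 4 * B * C in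
  let c4 := - (B * C) in let c6 := (4 * B * D) ^+ 2 in
  0 < t0 -> resolvent al be ga t0 < 0 ->
  m ^+ 2 = quartic al be ga n -> m != 0 -> 2 * (n ^+ 2 + m) + al = 4 * x ->
  x != 0 -> cubic A c4 c6 x 1 != 0 ->
  exists n' m' x', [/\ m' ^+ 2 = quartic al be ga n', 0 < m',
    2 * (n' ^+ 2 + m') + al = 4 * x' &
    x' * (4 * cubic A c4 c6 x 1) = dup A c4 c6 x 1].
Proof.
move=> al be ga c4 c6 t0_gt0 ft0 mE m0 tE x0 r0.
have rE : resolvent al be ga (4 * x) = 64 * cubic A c4 c6 x 1 by exact: resolvent_cubic.
have x4 : 4 * x != 0 by rewrite mulf_neq0 ?pnatr_eq0.
have r64 : 64 * cubic A c4 c6 x 1 != 0 by rewrite mulf_neq0 ?pnatr_eq0.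
have := double_point t0_gt0 ft0 mE m0.
rewrite tE rE => /(_ x4 r64) [n' [m' [e pos tt]]].
exists n', m', ((2 * (n' ^+ 2 + m') + al) / 4); split; [exact: e|exact: pos|by field|].
set T := 2 * _ + al in tt *; clearbody T.
have -> : T / 4 * (4 * cubic A c4 c6 x 1) =
  T * (4 * (64 * cubic A c4 c6 x 1)) / 256 by field.
by rewrite tt /dup /c4 /c6 /al /be /ga; field.
Qed.

(* [x] is the Weierstrass abscissa [t] divided by 4, which keeps the model
   integral. *)
Definition curve_point (F : realFieldType) (A B C D n m x : F) : Prop :=
  m ^+ 2 = quartic (- (2 * A)) (- (32 * B * D)) (A ^+ 2 + 4 * B * C) n /\
  2 * (n ^+ 2 + m) - 2 * A = 4 * x.

(** Follows an explicit fraction for [x] through one doubling; cancelling the common factor [g]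
    exposes the power of 2 in the denominator. *)
Lemma dup_frac_point (A B C D u w g u' w' : Z) (t0 n m x : rat) :
  let q := rat_of_Z in let c4 := (- (B * C))%R in let c6 := ((4 * B * D) ^+ 2)%R in
  0 < t0 ->
  resolvent (- (2 * q A)) (- (32 * q B * q D)) (q A ^+ 2 + 4 * q B * q C) t0 < 0 ->
  curve_point (q A) (q B) (q C) (q D) n m x -> m != 0 -> x * q w = q u ->
  u != 0 -> g != 0 -> cubic A c4 c6 u w != 0 ->
  dup A c4 c6 u w = g * u' -> 4 * w * cubic A c4 c6 u w = g * w' ->
  exists n' m' x', [/\ curve_point (q A) (q B) (q C) (q D) n' m' x', 0 < m' &
     x' * q w' = q u'].
Proof.
move=> q c4 c6 t0_gt0 ft0 [mE tE] m0 xw u0 g0 cub0 dE wE.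
have q0 z : z != 0 -> q z != 0.
  by apply: contraNneq => E; apply/eqP/rat_of_Z_inj; rewrite -/q E /q rmorph0.
have x0 : x != 0.
  by apply: contraNneq (q0 _ u0) => E; rewrite -xw E mul0r.
have c4E : q c4 = - (q B * q C) by rewrite /q /c4; ring.
have c6E : q c6 = (4 * q B * q D) ^+ 2 by rewrite /q /c6; ring.
have cx0 : cubic (q A) (q c4) (q c6) x 1 != 0.
  apply: contraNneq (q0 _ cub0) => E.
  have -> : q (cubic A c4 c6 u w) = cubic (q A) (q c4) (q c6) (q u) (q w).
    by rewrite /q /cubic; ring.
  apply/eqP; rewrite -xw; apply: etrans (_ : q w ^+ 3 * cubic (q A) (q c4) (q c6) x 1 = _).
    by rewrite /cubic; ring.
  by rewrite E mulr0.
rewrite c4E c6E in cx0.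
have [n' [m' [x' [e pos t'E x'E]]]] := double_dup t0_gt0 ft0 mE m0 tE x0 cx0.
exists n', m', x'; split=> //.
rewrite -c4E -c6E in x'E.
have := dup_frac xw x'E; rewrite dE wE rat_of_ZM mulrCA rat_of_ZM => /mulfI; apply.
exact: q0.
Qed.

(** Each doubling lowers the valuation of [x] by 2, so all the [x] differ. The [n] then differ too,
    since on [m > 0] the value of [n] determines [m], and with it [x]. *)
Lemma doubling_orbit (A B C D : Z) (t0 n m x : rat) (k : nat) :
  let q := rat_of_Z in
  let al := - (2 * q A) in let be := - (32 * q B * q D) in
  let ga := q A ^+ 2 + 4 * q B * q C in
  0 < t0 -> resolvent al be ga t0 < 0 ->
  curve_point (q A) (q B) (q C) (q D) n m x -> 0 < m -> has_val2 k.+1 x ->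
  exists X Y : nat -> rat, injective X /\
    forall i, Y i ^+ 2 = quartic al be ga (X i) /\ 0 < Y i.
Proof.
move=> q al be ga t0_gt0 ft0 cp m_gt0 xk.
have orbit i : exists z : rat * rat * rat,
    [/\ curve_point (q A) (q B) (q C) (q D) z.1.1 z.1.2 z.2, 0 < z.1.2 &
        has_val2 (k + i.*2).+1 z.2].
  elim: i => [|i [[[n' m'] x'] /= [cp' m'_gt0 x'k]]].
    by exists (n, m, x); rewrite addn0.
  have [x0 [cx0 nxt]] := has_val2_dup A (- (B * C)) ((4 * B * D) ^+ 2) x'k.
  have c4E : q (- (B * C)) = - (q B * q C) by rewrite /q; ring.
  have c6E : q ((4 * B * D) ^+ 2) = (4 * q B * q D) ^+ 2 by rewrite /q; ring.
  rewrite -/q c4E c6E in cx0 nxt.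
  have [mE tE] := cp'.
  have [n2 [m2 [x2 [e pos t2E x2E]]]] :=
    double_dup t0_gt0 ft0 mE (lt0r_neq0 m'_gt0) tE x0 cx0.
  exists (n2, m2, x2); split=> //=.
  by rewrite doubleS !addnS; exact: nxt.
have [z zP] := boolp.choice orbit.
exists (fun i => (z i).1.1), (fun i => (z i).1.2); split; last first.
  by move=> i; have [[e _] pos _] := zP i.
move=> i j /= nij.
have [[ei ti] posi vi] := zP i; have [[ej tj] posj vj] := zP j.
have mij : (z i).1.2 = (z j).1.2.
  have : (z i).1.2 ^+ 2 == (z j).1.2 ^+ 2 by rewrite ei ej nij.
  by rewrite eqrXn2 ?(ltW posi) ?(ltW posj) // => /eqP.
have xij : (z i).2 = (z j).2.
  by apply: (mulfI (_ : 4 != 0 :> rat)); rewrite ?pnatr_eq0 // -ti -tj nij mij.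
rewrite xij in vi; have := has_val2_inj vi vj.
by move=> [] /addnI /double_inj.
Qed.

Lemma point_of_frac (A B C D a b c u w : Z) :
  let q := rat_of_Z in
  b != 0 -> c != 0 -> w != 0 ->
  c ^+ 2 = a ^+ 4 - 2 * A * a ^+ 2 * b ^+ 2 - 32 * B * D * a * b ^+ 3
    + (A ^+ 2 + 4 * B * C) * b ^+ 4 ->
  (2 * (a ^+ 2 + c) - 2 * A * b ^+ 2) * w = 4 * b ^+ 2 * u ->
  exists n m x, [/\ curve_point (q A) (q B) (q C) (q D) n m x, m != 0 &
    x * q w = q u].
Proof.
move=> q b0 c0 w0 e1 e2.
have q0 z : z != 0 -> q z != 0.
  by apply: contraNneq => E; apply/eqP/rat_of_Z_inj; rewrite -/q E /q rmorph0.
exists (q a / q b), (q c / q b ^+ 2), (q u / q w).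
split; [|by rewrite mulf_neq0 ?invr_neq0 ?expf_neq0 ?q0|by rewrite divfK ?q0].
have {}e1 : q c ^+ 2 = q a ^+ 4 - 2 * q A * q a ^+ 2 * q b ^+ 2
   - 32 * q B * q D * q a * q b ^+ 3 + (q A ^+ 2 + 4 * q B * q C) * q b ^+ 4.
  by have := congr1 q e1 => h; apply: etrans (etrans h _); rewrite /q; ring.
have {}e2 : (2 * (q a ^+ 2 + q c) - 2 * q A * q b ^+ 2) * q w = 4 * q b ^+ 2 * q u.
  by have := congr1 q e2 => h; apply: etrans (etrans h _); rewrite /q; ring.
move: (q0 _ b0) (q0 _ w0) => {}b0 {}w0; split.
  by rewrite expr_div_n e1 /quartic; field.
apply: (mulIf w0); apply: (mulIf (_ : q b ^+ 2 != 0)); first by rewrite expf_neq0.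
by apply: etrans (etrans e2 _); field; rewrite ?w0 ?b0.
Qed.


Lemma rat_of_Z_lt0 (z : Z) : (z <? 0)%Z -> rat_of_Z z < 0.
Proof. by case: z => // p _; rewrite /rat_of_Z /= ltrz0. Qed.

Lemma rational_orbit (A B C D : Z) : let q := rat_of_Z in
  let al := - (2 * q A) in let be := - (32 * q B * q D) in
  let ga := q A ^+ 2 + 4 * q B * q C in
  A = 2121%Z -> B = 624%Z -> C = 23088%Z -> D = 46%Z ->
  exists t0, [/\ 0 < t0, resolvent al be ga t0 < 0 &
  exists X Y : nat -> rat, injective X /\
    forall i, Y i ^+ 2 = quartic al be ga (X i) /\ 0 < Y i].
Proof.
move=> q al be ga AE BE CE DE.
(* The constants stay behind equations because conversion between closed rational
   terms built from them blows up. *)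
have [T TE] : exists T, T = 6400%Z by eexists.
have T_gt0 : 0 < q T.
  have : q (- T) < 0 by apply: rat_of_Z_lt0; rewrite TE; vm_compute.
  by rewrite /q rmorphN oppr_lt0.
have neg : resolvent al be ga (q T) < 0.
  have -> : resolvent al be ga (q T) =
    q (T * ((T + 2 * A) ^+ 2 - 4 * (A ^+ 2 + 4 * B * C)) + (32 * B * D) ^+ 2).
    by rewrite /resolvent /al /be /ga /q; ring.
  by apply: rat_of_Z_lt0; rewrite TE AE BE CE DE; vm_compute.
exists (q T); split=> //.
rewrite /al /be /ga in neg *.
pose c4 : Z := (- (B * C))%R; pose c6 : Z := ((4 * B * D) ^+ 2)%R.
have [u0 u0E] : exists u, u = 51989899936%Z by eexists.
have [w0 w0E] : exists u, u = 400200025%Z by eexists.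
(* [(a / b, c / b^2)] is three times the point [t = 0], and its [x] is [u0 / w0]:
   the multiple by 24 is the first one 2-adically close to infinity. *)
have [a aE] : exists u, u = 185212558146463%Z by eexists.
have [b bE] : exists u, u = 108701708635%Z by eexists.
have [c cE] : exists u, u = (-34275559784749064805063757856)%Z by eexists.
have [g1 g1E] : exists u, u = 4096%Z by eexists.
have [g2 g2E] : exists u, u = 1048576%Z by eexists.
have [u1 u1E] : exists u, u = (dup A c4 c6 u0 w0 / g1)%Z by eexists.
have [w1 w1E] : exists u, u = (4%Z * w0 * cubic A c4 c6 u0 w0 / g1)%Z by eexists.
have [u2 u2E] : exists u, u = (dup A c4 c6 u1 w1 / g2)%Z by eexists.
have [w2 w2E] : exists u, u = (4%Z * w1 * cubic A c4 c6 u1 w1 / g2)%Z by eexists.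
(* After this third doubling the numerator is [2 u3 + 1] and the denominator is [2^6 (2 w3 + 1)];
   the truncated quotients by 2 and 128 extract [u3] and [w3]. *)
have [u3 u3E] : exists u, u = (dup A c4 c6 u2 w2 / 2)%Z by eexists.
have [w3 w3E] : exists u, u = (4%Z * w2 * cubic A c4 c6 u2 w2 / 128)%Z by eexists.
have cst := (AE, BE, CE, DE).
have [n [m [x [cp m0 xw]]]] : exists n m x,
    [/\ curve_point (q A) (q B) (q C) (q D) n m x, m != 0 & x * q w0 = q u0].
  apply: (@point_of_frac A B C D a b c u0 w0).
  - by rewrite bE; vm_compute.
  - by rewrite cE; vm_compute.
  - by rewrite w0E; vm_compute.
  - by rewrite aE bE cE !cst; vm_compute.
  - by rewrite aE bE cE u0E w0E !cst; vm_compute.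
have [n1 [m1 [x1 [cp1 m10 xw1]]]] : exists n' m' x',
    [/\ curve_point (q A) (q B) (q C) (q D) n' m' x', 0 < m' & x' * q w1 = q u1].
  apply: (@dup_frac_point A B C D _ _ g1 u1 w1 (q T) _ _ _ T_gt0 neg cp m0 xw).
  - by rewrite u0E; vm_compute.
  - by rewrite g1E; vm_compute.
  - by rewrite u0E w0E !cst; vm_compute.
  - by rewrite u1E g1E /c4 /c6 u0E w0E !cst; vm_compute.
  - by rewrite w1E g1E /c4 /c6 u0E w0E !cst; vm_compute.
have [n2 [m2 [x2 [cp2 m20 xw2]]]] : exists n' m' x',
    [/\ curve_point (q A) (q B) (q C) (q D) n' m' x', 0 < m' & x' * q w2 = q u2].
  apply: (@dup_frac_point A B C D _ _ g2 u2 w2 (q T) _ _ _ T_gt0 neg cp1 (lt0r_neq0 m10) xw1).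
  - by rewrite u1E g1E /c4 /c6 u0E w0E !cst; vm_compute.
  - by rewrite g2E; vm_compute.
  - by rewrite w1E u1E g1E /c4 /c6 u0E w0E !cst; vm_compute.
  - by rewrite u2E w1E u1E g2E g1E /c4 /c6 u0E w0E !cst; vm_compute.
  - by rewrite w2E w1E u1E g2E g1E /c4 /c6 u0E w0E !cst; vm_compute.
have [n3 [m3 [x3 [cp3 m30 xw3]]]] : exists n' m' x',
    [/\ curve_point (q A) (q B) (q C) (q D) n' m' x', 0 < m' &
        x' * q (2 ^+ 6 * (2 * w3 + 1)) = q (2 * u3 + 1)].
  apply: (@dup_frac_point A B C D _ _ 1 _ _ (q T) _ _ _ T_gt0 neg cp2 (lt0r_neq0 m20) xw2).
  - by rewrite u2E w1E u1E g2E g1E /c4 /c6 u0E w0E !cst; vm_compute.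
  - by [].
  - by rewrite w2E u2E w1E u1E g2E g1E /c4 /c6 u0E w0E !cst; vm_compute.
  - by rewrite u3E w2E u2E w1E u1E g2E g1E /c4 /c6 u0E w0E !cst; vm_compute.
  - by rewrite w3E w2E u2E w1E u1E g2E g1E /c4 /c6 u0E w0E !cst; vm_compute.
apply: (doubling_orbit (k := 5) T_gt0 neg cp3 m30).
by exists u3, w3.
Qed.

(** * Lyness sequences of period 9 *)

(** The hypothesis is the invariant cubic at the level [h = (a - 1) (a^2 - a + 1) / a]. Closed forms
    of the forward iterates and of the backward ones are matched in the middle. *)
Lemma lyness_has_period9 (a x y : rat) : 0 < a -> 0 < x -> 0 < y ->
  a * (x + 1) * (y + 1) * (x + y + a) =
    (a ^+ 3 - 2 * a ^+ 2 + 2 * a - 1) * x * y ->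
  has_period (lyness a x y) 9.
Proof.
move=> a0 x0 y0 rel.
pose f (u : rat * rat) := (u.2, (a + u.2) / u.1).
have fE u v w : u != 0 -> w * u = a + v -> f (u, v) = (v, w).
  by move=> u0 h; rewrite /f /= -h mulfK.
suff per : iter 9 f (x, y) = (x, y).
  by move=> n; rewrite /lyness -/f iterD per.
have p1 : 0 < a * x + a + y by rewrite !addr_gt0 ?mulr_gt0.
have p2 : 0 < a * x * y + a * x + a + y by rewrite !addr_gt0 ?mulr_gt0.
have p3 : 0 < a * y + a + x by rewrite !addr_gt0 ?mulr_gt0.
have p4 : 0 < a * x * y + a * y + a + x by rewrite !addr_gt0 ?mulr_gt0.
have p5 : 0 < a * x * (a + x) + a * x * y + a * y + a + x.
  by rewrite !addr_gt0 ?mulr_gt0 // addr_gt0.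
have ax : 0 < a + x by exact: addr_gt0.
have ay : 0 < a + y by exact: addr_gt0.
pose z2 := (a + y) / x; pose z3 := (a * x + a + y) / (x * y).
pose z4 := (a * x * y + a * x + a + y) / (y * (a + y)).
(* From here on the backward iterates of index -4, ..., -1. *)
pose z5 := (a * x * (a + x) + a * x * y + a * y + a + x) * y /
  ((a + x) * (a * y + a + x)).
pose z6 := (a * x * y + a * y + a + x) / (x * (a + x)).
pose z7 := (a * y + a + x) / (x * y); pose z8 := (a + x) / y.
have [nx ny nax nay] : [/\ x != 0, y != 0, a + x != 0 & a + y != 0] by rewrite !lt0r_neq0.
have [n1 n2 n3 n4] : [/\ a * x + a + y != 0, a * x * y + a * x + a + y != 0,
  a * y + a + x != 0 & a * x * y + a * y + a + x != 0] by rewrite !lt0r_neq0.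
have n5 : a * x * (a + x) + a * x * y + a * y + a + x != 0 by rewrite lt0r_neq0.
have rel0 : a * (x + 1) * (y + 1) * (x + y + a) -
    (a ^+ 3 - 2 * a ^+ 2 + 2 * a - 1) * x * y = 0 by rewrite rel subrr.
(* Only [e5] and [e6], where the two halves meet, depend on the cubic relation: each defect is a
   multiple of it. *)
have e5 : z5 * z3 = a + z4.
  apply/eqP; rewrite -subr_eq0; apply/eqP.
  apply: etrans (_ : (a * (x + 1) * (y + 1) * (x + y + a) -
    (a ^+ 3 - 2 * a ^+ 2 + 2 * a - 1) * x * y) * ((y - x) * (a + x + y)) /
    (x * (a + x) * (a * y + a + x) * y * (a + y)) = _).
    by rewrite /z5 /z3 /z4; field; rewrite nx ny nax nay n3.
  by rewrite rel0 !mul0r.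
have e6 : z6 * z4 = a + z5.
  apply/eqP; rewrite -subr_eq0; apply/eqP.
  apply: etrans (_ : (a * (x + 1) * (y + 1) * (x + y + a) -
    (a ^+ 3 - 2 * a ^+ 2 + 2 * a - 1) * x * y) * ((y + 1) * (a + x - x * y)) /
    (x * (a + x) * (a * y + a + x) * y * (a + y)) = _).
    by rewrite /z6 /z4 /z5; field; rewrite nx ny nax nay n3.
  by rewrite rel0 !mul0r.
rewrite iterSr (fE _ _ z2) //; last by rewrite /z2; field.
rewrite iterSr (fE _ _ z3) //; last by rewrite /z3 /z2; field; rewrite nx ny.
rewrite iterSr (fE _ _ z4); last 2 first.
- by rewrite /z2 mulf_neq0 ?invr_neq0.
- by rewrite /z4 /z3 /z2; field; rewrite nx ny nay.
rewrite iterSr (fE _ _ z5); [|by rewrite /z3 !mulf_neq0 ?invr_neq0 ?mulf_neq0|exact: e5].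
rewrite iterSr (fE _ _ z6); [|by rewrite /z4 !mulf_neq0 ?invr_neq0 ?mulf_neq0|exact: e6].
rewrite iterSr (fE _ _ z7); last 2 first.
- by rewrite /z5 !mulf_neq0 ?invr_neq0 ?mulf_neq0.
- by rewrite /z7 /z6 /z5; field; rewrite nx ny nax n3.
rewrite iterSr (fE _ _ z8); last 2 first.
- by rewrite /z6 !mulf_neq0 ?invr_neq0 ?mulf_neq0.
- by rewrite /z8 /z7 /z6; field; rewrite nx ny nax.
rewrite iterSr (fE _ _ x); last 2 first.
- by rewrite /z7 !mulf_neq0 ?invr_neq0 ?mulf_neq0.
- by rewrite /z8 /z7; field; rewrite nx ny.
rewrite iterSr (fE _ _ y) //; first by rewrite /z8 mulf_neq0 ?invr_neq0.
by rewrite /z8; field.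
Qed.

(** Differences of the three cyclic equations factor, for instance as [(x - y) (1 + z) = 0], and
    positivity leaves only the fixed point of the recurrence. *)
Lemma lyness_period3 (a x y : rat) : 0 < a -> 0 < x -> 0 < y ->
  has_period (lyness a x y) 3 -> x = y /\ a = x ^+ 2 - x.
Proof.
move=> a0 x0 y0 per.
have nx := lt0r_neq0 x0; have ny := lt0r_neq0 y0.
pose z := (a + y) / x; have z0 : 0 < z by rewrite divr_gt0 // addr_gt0.
have h2 : z * x = a + y by rewrite /z divfK.
have h3 : x * y = a + z.
  by have := per 0%N; rewrite lyness0 add0n !lynessSS lyness0 lyness1 -/z => <-; rewrite divfK.
have h4 : y * z = a + x.
  have := per 1%N; rewrite lyness1 lynessSS (per 0%N) lyness0 lynessSS lyness0 lyness1 -/z => <-.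
  by rewrite divfK // lt0r_neq0.
have xy : x = y.
  apply/eqP; rewrite -subr_eq0; have /eqP : (x - y) * (1 + z) = 0.
    have -> : (x - y) * (1 + z) = (a + x - y * z) - (a + y - z * x) by ring.
    by rewrite h2 h4 !subrr.
  by rewrite mulf_eq0 => /orP[//|]; rewrite gt_eqF // addr_gt0.
split=> //; have zx : z = x.
  apply/eqP; rewrite -subr_eq0; have /eqP : (z - x) * (1 + x) = 0.
    have -> : (z - x) * (1 + x) = (a + z - x * x) - (a + x - z * x) by ring.
    have e : x * x = a + z by rewrite {2}xy.
    by rewrite e h2 -xy !subrr.
  by rewrite mulf_eq0 => /orP[//|]; rewrite gt_eqF // addr_gt0.
by move: h2; rewrite zx -xy => h; rewrite expr2 h addrK.
Qed.

Lemma has_period_mul (T : Type) (u : nat -> T) p k :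
  has_period u p -> has_period u (k * p).
Proof. by move=> up n; elim: k => [|k IHk]; rewrite ?mul0n ?addn0 // mulSnr addnA up. Qed.

Lemma has_period_sub (T : Type) (u : nat -> T) p q :
  has_period u p -> has_period u (q + p) -> has_period u q.
Proof. by move=> up uqp n; rewrite -(up (n + q)%N) -addnA uqp. Qed.

Lemma lyness9_mem (a x y : rat) : 0 < a -> 0 < x -> 0 < y ->
  a * (x + 1) * (y + 1) * (x + y + a) =
    (a ^+ 3 - 2 * a ^+ 2 + 2 * a - 1) * x * y ->
  ~ (x = y /\ a = x ^+ 2 - x) -> lyness9_values a.
Proof.
move=> a0 x0 y0 rel ncst; split=> //; exists x, y; split=> //.
have per := lyness_has_period9 a0 x0 y0 rel; split=> // q q0 perq.
rewrite leqNgt; apply/negP => q9; apply: ncst; apply: lyness_period3 => //.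
(* For [1 <= q <= 8] the gcd of [q] and 9 divides 3, so some multiple of [q] is 3 modulo 9 and 3
   would be a period. *)
have red k l : (k * q = 3 + l * 9)%N -> has_period (lyness a x y) 3.
  move=> kq; apply: (has_period_sub (has_period_mul l per)).
  by rewrite -kq; exact: has_period_mul.
case: q q0 q9 {perq} red => [|[|[|[|[|[|[|[|[|q]]]]]]]]] // _ _ red.
- exact: (red 3 0).
- exact: (red 6 1).
- exact: (red 1 0).
- exact: (red 3 1).
- exact: (red 6 3).
- exact: (red 2 1).
- exact: (red 3 2).
- exact: (red 6 5).
Qed.

(** * The slice [x + y = 23/4] and its quartic model *)

Lemma lyness_curve (F : realFieldType) (A B C D V W : F) :
  A = 2121 -> B = 624 -> C = 48 * 481 -> D = 46 -> 0 < V ->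
  W ^+ 2 = - B * V ^+ 3 + A * V ^+ 2 + C * V + (4 * D) ^+ 2 ->
  let a := 4 + 12 / V in let k := W / (23 * (8 + 3 * V)) in
  let x := 23 / 8 * (1 + k) in let y := 23 / 8 * (1 - k) in
  [/\ 0 < a, 0 < x, 0 < y & a * (x + 1) * (y + 1) * (x + y + a) =
    (a ^+ 3 - 2 * a ^+ 2 + 2 * a - 1) * x * y] /\ ~ (x = y /\ a = x ^+ 2 - x).
Proof.
move=> -> -> -> -> V0 WE a k x y.
have d0 : 0 < 23 * (8 + 3 * V) by lra.
have nV := lt0r_neq0 V0; have nd := lt0r_neq0 d0.
have kE : k ^+ 2 * (23 * (8 + 3 * V)) ^+ 2 =
    - 624 * V ^+ 3 + 2121 * V ^+ 2 + (48 * 481) * V + (4 * 46) ^+ 2.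
  by rewrite -WE /k expr_div_n divfK // expf_neq0.
(* The cubic is below [(23 (8 + 3 V))^2] term by term, with equal constant terms [184^2]; this makes
   [x] and [y] positive. *)
have k1 : k ^+ 2 < 1.
  rewrite -(ltr_pM2r (exprn_gt0 2 d0)) kE mul1r.
  have V2 : 0 < V ^+ 2 by exact: exprn_gt0.
  have V3 : 0 < V ^+ 3 by exact: exprn_gt0.
  lra.
have [k2 k3] : -1 < k /\ k < 1 by split; nra.
split; last first.
  case=> xy.
  have k0 : k = 0 by move: xy; rewrite /x /y; lra.
  rewrite /a /x k0 => aE.
  (* A constant sequence would be [x = y = 23/8] with [a = 345/64], but [V = 768/89] is not a root
     of the cubic. *)
  have VE : 89 * V = 768.
    have aE' : 12 / V = 345 / 64 - 4 by lra.
    have : (345 / 64 - 4) * V = 12 by rewrite -aE' divfK.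
    lra.
  have V2 : 89 * V ^+ 2 = 768 * V by rewrite expr2 mulrA VE.
  have V3 : 89 * V ^+ 3 = 768 * V ^+ 2 by rewrite exprS mulrA VE.
  have K0 : k ^+ 2 * (23 * (8 + 3 * V)) ^+ 2 = 0 by rewrite k0 expr0n mul0r.
  by move: K0; rewrite kE; lra.
split; [by rewrite addr_gt0 // divr_gt0|by rewrite /x; lra|by rewrite /y; lra|].
apply/eqP; rewrite -subr_eq0; apply/eqP.
pose g := - 624 * V ^+ 3 + 2121 * V ^+ 2 + (48 * 481) * V + (4 * 46) ^+ 2.
apply: etrans (_ : 27 / (64 * V ^+ 3) * (k ^+ 2 * (23 * (8 + 3 * V)) ^+ 2 - g) = _).
  by clearbody k; rewrite /a /x /y /g; field.
by rewrite kE subrr mulr0.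
Qed.

(** Substituting the line [W = 4 D + n V] and dividing by [V] leaves the quadratic [VE]. Its
    discriminant is the quartic, so [m] is a square root of it and [V] a root of the quadratic. *)
Lemma curve_of_quartic (F : realFieldType) (A B C D n m : F) : B != 0 ->
  m ^+ 2 = quartic (- (2 * A)) (- (32 * B * D)) (A ^+ 2 + 4 * B * C) n ->
  let V := (A - n ^+ 2 + m) / (2 * B) in
  (4 * D + n * V) ^+ 2 = - B * V ^+ 3 + A * V ^+ 2 + C * V + (4 * D) ^+ 2.
Proof.
move=> B0 mE V.
have VE : B * V ^+ 2 + (n ^+ 2 - A) * V + 8 * D * n - C = 0.
  apply: etrans (_ : (m ^+ 2 - quartic (- (2 * A)) (- (32 * B * D))
    (A ^+ 2 + 4 * B * C) n) / (4 * B) = _); last by rewrite mE subrr mul0r.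
  by rewrite /V /quartic; field.
by apply: (eq_of_cert (k := V)) VE; ring.
Qed.

Lemma quartic_of_curve (F : realFieldType) (A B C D V W : F) : V != 0 ->
  W ^+ 2 = - B * V ^+ 3 + A * V ^+ 2 + C * V + (4 * D) ^+ 2 ->
  let n := (W - 4 * D) / V in
  (2 * B * V - A + n ^+ 2) ^+ 2 =
    quartic (- (2 * A)) (- (32 * B * D)) (A ^+ 2 + 4 * B * C) n.
Proof.
move=> V0 WE n; apply/eqP; rewrite -subr_eq0; apply/eqP.
apply: etrans (_ : 4 * B / V * (W ^+ 2 -
  (- B * V ^+ 3 + A * V ^+ 2 + C * V + (4 * D) ^+ 2)) = _).
  by rewrite /n /quartic; field.
by rewrite WE subrr mulr0.
Qed.

Lemma dense_quartic (A B C D c d : rat) :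
  A = 2121 -> B = 624 -> C = 48 * 481 -> D = 46 -> c < d ->
  exists n m, [/\ m ^+ 2 = quartic (- (2 * A)) (- (32 * B * D)) (A ^+ 2 + 4 * B * C) n,
    0 < m, c < n & n < d].
Proof.
have q_nat (z : Z) (k : nat) : z = k%:R -> rat_of_Z z = k%:R.
  by move=> ->; exact: rmorph_nat.
have q_natM (z : Z) (k l : nat) : z = k%:R * l%:R -> rat_of_Z z = k%:R * l%:R.
  by move=> ->; rewrite rat_of_ZM; congr (_ * _); exact: rmorph_nat.
have := rational_orbit (erefl 2121%Z) (erefl 624%Z) (erefl 23088%Z) (erefl 46%Z).
move=> [t0 [t0_gt0 ft0 [X [Y [Xinj XY]]]]].
have {}q1 : rat_of_Z 2121%Z = 2121 by apply: q_nat; vm_compute.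
have {}q2 : rat_of_Z 624%Z = 624 by apply: q_nat; vm_compute.
have {}q3 : rat_of_Z 23088%Z = 48 * 481 by apply: q_natM; vm_compute.
have {}q4 : rat_of_Z 46%Z = 46 by apply: q_nat; vm_compute.
rewrite -q1 -q2 -q3 -q4 => -> -> -> -> cd.
exact: dense_points t0_gt0 ft0 (unbounded_points t0_gt0 ft0 Xinj XY) cd.
Qed.

Lemma curve_mem (n m V : rat) (A B C D : rat) :
  A = 2121 -> B = 624 -> C = 48 * 481 -> D = 46 ->
  m ^+ 2 = quartic (- (2 * A)) (- (32 * B * D)) (A ^+ 2 + 4 * B * C) n ->
  V = (A - n ^+ 2 + m) / (2 * B) -> 0 < V -> lyness9_values (4 + 12 / V).
Proof.
move=> AE BE CE DE mE VE V0.
have B0 : B != 0 by rewrite BE pnatr_eq0.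
have := curve_of_quartic B0 mE; rewrite /= -VE => WE.
move: (4 * D + n * V) WE => W WE.
have [[a0 x0 y0 rel] ncst] := lyness_curve AE BE CE DE V0 WE.
exact: lyness9_mem a0 x0 y0 rel ncst.
Qed.

(** * Approximation of real parameters *)

Lemma horner_lyness9_poly (R : realType) (a : R) : (lyness9_poly R).[a] =
  a ^+ 3 - 2019 / 529 * a ^+ 2 - 777 / 92 * a - 1.
Proof. by rewrite /lyness9_poly !hornerE. Qed.

Lemma quartic_continuous (R : realType) (al be ga : R) : continuous (quartic al be ga).
Proof.
move=> x; rewrite /quartic; apply: cvgD; last exact: cvg_cst.
apply: cvgD; last by apply: cvgM; [exact: cvg_cst|exact: cvg_id].
apply: cvgD; first exact: exprn_continuous.
by apply: cvgM; [exact: cvg_cst|exact: exprn_continuous].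
Qed.

Lemma ratr_natM (F : numFieldType) (k l : nat) : ratr (k%:R * l%:R) = k%:R * l%:R :> F.
Proof. by rewrite rmorphM /= !ratr_nat. Qed.

Lemma ratr_natDV (F : numFieldType) (k l : nat) (x : rat) :
  ratr (k%:R + l%:R / x) = k%:R + l%:R / ratr x :> F.
Proof. by rewrite rmorphD rmorphM fmorphV /= !ratr_nat. Qed.

(** The target [a0] comes from a real point [(n0, m0)] of the quartic. On a fixed branch of the
    square root, [a] is continuous in [n], so rational points with [n] near [n0] give values near
    [a0]. *)
Lemma approx_of_dense (R : realType) (A B C D : rat) (S : set rat) (a0 e : R) :
  let al := - (2 * A) in let be := - (32 * B * D) in let ga := A ^+ 2 + 4 * B * C in
  (forall c d : rat, c < d ->
     exists n m, [/\ m ^+ 2 = quartic al be ga n, 0 < m, c < n & n < d]) ->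
  (forall n m V : rat, m ^+ 2 = quartic al be ga n ->
     V = (A - n ^+ 2 + m) / (2 * B) -> 0 < V -> S (4 + 12 / V)) ->
  ratr A = 2121 :> R -> ratr B = 624 :> R -> ratr C = 48 * 481 :> R -> ratr D = 46 :> R ->
  4 < a0 -> 0 <= (lyness9_poly R).[a0] -> 0 < e ->
  exists2 a, S a & `|a0 - ratr a| < e.
Proof.
move=> al' be' ga' dense mem AR BR CR DR.
rewrite horner_lyness9_poly => a4 pa0 e0.
have B0 : ratr B != 0 :> R by rewrite BR pnatr_eq0.
have d0 : 0 < a0 - 4 by rewrite subr_gt0.
pose V0 := 12 / (a0 - 4); have V0_gt0 : 0 < V0 by rewrite divr_gt0.
pose g := - ratr B * V0 ^+ 3 + ratr A * V0 ^+ 2 + ratr C * V0 + (4 * ratr D) ^+ 2.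
have g0 : 0 <= g.
  have -> : g = (4 * 46) ^+ 2 * (a0 ^+ 3 - 2019 / 529 * a0 ^+ 2 - 777 / 92 * a0 - 1) /
      (a0 - 4) ^+ 3.
    by rewrite /g AR BR CR DR /V0; field; rewrite lt0r_neq0.
  apply: divr_ge0; last by apply: exprn_ge0; exact: ltW.
  by apply: mulr_ge0; [exact: sqr_ge0|exact: pa0].
have := quartic_of_curve (lt0r_neq0 V0_gt0) (sqr_sqrtr g0) => /=.
set n0 := _ / V0; set m0 := 2 * _ * V0 - _ + _.
set al := - (2 * ratr A); set be := - (32 * _ * _); set ga := ratr A ^+ 2 + _ => m0E.
(* The dense points have [m > 0] while [m0] may be negative; the sign [s] moves them to the branch
   of [m0]. *)
pose s : rat := if 0 <= m0 then 1 else -1.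
have m0s : m0 = ratr s * Num.sqrt (quartic al be ga n0).
  rewrite -m0E sqrtr_sqr /s; have [m00|m00] := lerP 0 m0.
    by rewrite rmorph1 mul1r ger0_norm.
  by rewrite rmorphN rmorph1 ltr0_norm // mulN1r opprK.
have s2 : s ^+ 2 = 1 by rewrite /s; case: ifP; rewrite ?sqrrN expr1n.
pose phi n := (ratr A - n ^+ 2 + ratr s * Num.sqrt (quartic al be ga n)) / (2 * ratr B).
have phi0 : phi n0 = V0 by rewrite /phi -m0s /m0; field.
have phi_cont : phi n @[n --> n0] --> V0.
  rewrite -phi0; apply: cvgM; last exact: cvg_cst.
  apply: cvgD.
    apply: cvgB; [exact: cvg_cst|exact: exprn_continuous].
  apply: cvgM; [exact: cvg_cst|].
  apply: (@continuous_comp _ _ _ (quartic al be ga) Num.sqrt).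
    exact: quartic_continuous.
  exact: sqrt_continuous.
have psi_cont : 4 + 12 / phi n @[n --> n0] --> a0.
  have -> : a0 = 4 + 12 / V0 by rewrite /V0; field; rewrite lt0r_neq0.
  apply: cvgD; first exact: cvg_cst.
  apply: cvgM; first exact: cvg_cst.
  by apply: cvgV => //; exact: lt0r_neq0.
have near_n0 : \forall n \near n0, 0 < phi n /\ `|a0 - (4 + 12 / phi n)| < e.
  near=> n; split; near: n; first exact: (cvgr_gt V0).
  exact: (cvgrPdist_lt _ _).1.
have [d /= d_gt0 dP] := (nbhs_ballP _ _).1 near_n0.
have [n0l n0r] : n0 - d < n0 /\ n0 < n0 + d by rewrite ltrBlDr ltrDl.
have [c1 /andP[c1l c1r]] : exists q : rat, n0 - d < ratr q < n0.
  by have [q] := rat_in_itvoo n0l; rewrite in_itv /=; exists q.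
have [c2 /andP[c2l c2r]] : exists q : rat, n0 < ratr q < n0 + d.
  by have [q] := rat_in_itvoo n0r; rewrite in_itv /=; exists q.
have c12 : c1 < c2 by rewrite -(ltr_rat R); exact: lt_trans c2l.
have [n [m [mE m_gt0 cn nc]]] := dense _ _ c12.
have nd : ball n0 d (ratr n : R).
  rewrite /ball /= ltr_norml; rewrite -!(ltr_rat R) in cn nc; clear -cn nc c1l c2r; apply/andP; split; lra.
have [phin ean] := dP _ nd.
pose V := (A - n ^+ 2 + s * m) / (2 * B).
have mR : ratr m = Num.sqrt (quartic al be ga (ratr n)) :> R.
  have -> : quartic al be ga (ratr n) = ratr m ^+ 2.
    rewrite -rmorphXn mE /quartic /al' /be' /ga' /al /be /ga; ring.
  by rewrite sqrtr_sqr gtr0_norm // ltr0q.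
have VR : ratr V = phi (ratr n).
  by rewrite /V /phi -mR fmorph_div; congr (_ / _); ring.
exists (4 + 12 / V); last first.
  by rewrite ratr_natDV VR.
apply: (mem n (s * m)) => //.
  by rewrite exprMn s2 mul1r.
by rewrite -(ltr0q R) VR.
Unshelve. all: by end_near.
Qed.

Lemma lyness9_values_approx (R : realType) (a0 e : R) :
  4 < a0 -> 0 <= (lyness9_poly R).[a0] -> 0 < e ->
  exists2 a, lyness9_values a & `|a0 - ratr a| < e.
Proof.
apply: (approx_of_dense (A := 2121) (B := 624) (C := 48 * 481) (D := 46)).
- by move=> c d; exact: dense_quartic (erefl _) (erefl _) (erefl _) (erefl _).
- by move=> n m V; exact: curve_mem (erefl _) (erefl _) (erefl _) (erefl _).
- exact: ratr_nat.
- exact: ratr_nat.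
- exact: ratr_natM.
- exact: ratr_nat.
Qed.

(** * The largest root and the conclusion *)

Lemma lyness9_poly_lt (R : realType) (r s : R) : 5 <= r -> r < s ->
  (lyness9_poly R).[r] < (lyness9_poly R).[s].
Proof.
move=> r5 rs; rewrite !horner_lyness9_poly -subr_gt0.
have -> : s ^+ 3 - 2019 / 529 * s ^+ 2 - 777 / 92 * s - 1 -
    (r ^+ 3 - 2019 / 529 * r ^+ 2 - 777 / 92 * r - 1) =
  (s - r) * (s ^+ 2 + s * r + r ^+ 2 - 2019 / 529 * (s + r) - 777 / 92) by field.
apply: mulr_gt0; first by rewrite subr_gt0.
have h1 : 0 <= (r - 5) * (s - 5) by apply: mulr_ge0; lra.
have h2 : 0 <= (r - 5) ^+ 2 by exact: sqr_ge0.
have h3 : 0 <= (s - 5) ^+ 2 by exact: sqr_ge0.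
lra.
Qed.

(** A sign change gives a root, and strict growth from 5 on excludes any larger one. *)
Lemma lyness9_poly_root (R : realType) (c h : R) : 5 <= c - h -> 0 <= h ->
  (lyness9_poly R).[c - h] < 0 -> 0 < (lyness9_poly R).[c + h] ->
  exists a1, biggest_root (lyness9_poly R) a1 /\ `|a1 - c| <= h.
Proof.
move=> ch h0 lo hi.
have := @poly_ivt R (lyness9_poly R) (c - h) (c + h).
case; [lra|by rewrite (ltW lo) (ltW hi)|].
move=> a1 /andP[l u] ra; exists a1; split; last first.
  by rewrite ler_norml; apply/andP; split; lra.
split=> // s rs; rewrite leNgt; apply/negP => as_.
have := lyness9_poly_lt (le_trans ch l) as_.
by rewrite (rootP ra) (rootP rs) ltxx.
Qed.

Lemma finite_rat_bounded (R : realType) (A : set rat) : finite_set A ->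
  exists M : R, forall a, A a -> ratr a <= M.
Proof.
move=> /finite_seqP [s ->].
exists (\sum_(a <- s) `|ratr a|); elim: s => [|b s IHs] a //=.
rewrite inE big_cons => /orP[/eqP ->|/IHs h].
  by apply: ler_wpDr; [exact: sumr_ge0|exact: ler_norm].
by apply: ler_wpDl.
Qed.

Theorem theorem2 (R : realType) :
  infinite_set lyness9_values /\
  exists a1 : R,
    [/\ biggest_root (lyness9_poly R) a1,
        `|a1 - (5%:R + 411%:R / 10%:R ^+ 3 + 476%:R / 10%:R ^+ 6 + 24%:R / 10%:R ^+ 8)|
          <= (10%:R ^+ 8)^-1 / 2%:R &
        `[a1, +oo[ `<=`
          closure [set (ratr a : R) | a in lyness9_values] ].
Proof.
set c := 5%:R + _ + _ + _; set h := _ / 2%:R.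
have ch : 5 <= c - h by rewrite /c /h; lra.
have [a1 [ba1 a1c]] : exists a1, biggest_root (lyness9_poly R) a1 /\ `|a1 - c| <= h.
  apply: lyness9_poly_root ch _ _ _.
  - by rewrite /h; lra.
  - by rewrite horner_lyness9_poly /c /h; lra.
  - by rewrite horner_lyness9_poly /c /h; lra.
have a15 : 5 <= a1 by move: a1c; rewrite ler_norml => /andP[l _]; clear -l ch; lra.
have approx x e : a1 <= x -> 0 < e -> exists2 a, lyness9_values a & `|x - ratr a| < e.
  move=> xa e0; apply: lyness9_values_approx => //; first by clear -xa a15; lra.
  have [-> |ne] := eqVneq x a1; first by rewrite (rootP ba1.1).
  have lt : a1 < x by rewrite lt_neqAle eq_sym ne.
  by have := lyness9_poly_lt a15 lt; rewrite (rootP ba1.1) => /ltW.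
split; last first.
  exists a1; split=> // x; rewrite /= in_itv /= andbT => xa.
  move=> U /nbhs_ballP [e /= e0 eU].
  have [a aS ae] := approx x e xa e0.
  by exists (ratr a); split; [exists a|exact: eU].
(* Finitely many values would be bounded by some [M], yet one lies within 1 of a real that is at
   least [M + 1]. *)
move=> /(finite_rat_bounded R) [M MP].
have [a aS] := approx (Num.max a1 (M + 1)) 1 ltac:(by rewrite le_max lexx) ltr01.
have := MP _ aS; have : M + 1 <= Num.max a1 (M + 1) by rewrite le_max lexx orbT.
move: (Num.max _ _) => y; rewrite ltr_norml => h1 h2 /andP[_ h3]; clear -h1 h2 h3; lra.
Qed.
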